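(* Let $n\ge 1$ and let $A\in\mathcal{M}_n(\mathbb{R})$. Then $W_{\mathbb{H}}(A)=\big[W_{\mathbb{C}}(A)\big]$, where $\big[W_{\mathbb{C}}(A)\big]=\bigcup_{w\in W_{\mathbb{C}}(A)}[w]$ is the union of the quaternionic similarity classes of the elements of $W_{\mathbb{C}}(A)$.
   Context: $\mathbb{H}$ denotes the real quaternions with basis $1,i,j,k$ (with $i^2=j^2=k^2=ijk=-1$), and $\mathbb{R}\subset\mathbb{C}=\mathrm{span}_{\mathbb{R}}\{1,i\}\subset\mathbb{H}$. For $q\in\mathbb{H}$, $q^*$ is the quaternionic conjugate and $|q|^2=qq^*$. Two quaternions $q_1,q_2$ are similar if there is a quaternion $s$ with $|s|=1$ and $s^*q_2s=q_1$; this is an equivalence relation, and $[q]\subset\mathbb{H}$ denotes the equivalence class of $q$. For $\mathbb{F}\in\{\mathbb{R},\mathbb{C},\mathbb{H}\}$, $\mathcal{M}_n(\mathbb{F})$ is the set of $n\times n$ matrices over $\mathbb{F}$, and the numerical range of $A\in\mathcal{M}_n(\mathbb{F})$ in $\mathbb{F}$ is $W_{\mathbb{F}}(A)=\{x^*Ax : x\in\mathbb{F}^n,\ |x|=1\}$, where $x$ is a column vector, $x^*$ its conjugate transpose, and $|x|^2=\sum_l |x_l|^2$. A real matrix is also regarded as a complex and as a quaternionic matrix via $\mathbb{R}\subset\mathbb{C}\subset\mathbb{H}$. *)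

(* Defs.v *)
From HB Require Import structures.
From mathcomp Require Import all_boot all_order all_algebra.
From mathcomp Require Import complex ring.
From mathcomp Require Import classical_sets reals.

Set Implicit Arguments.
Unset Strict Implicit.
Unset Printing Implicit Defensive.

Import Order.TTheory GRing.Theory Num.Theory.

Local Open Scope ring_scope.

(* Quat a b c d is a + b i + c j + d k. *)
Record quat (R : Type) : Type := Quat { qre : R; qi : R; qj : R; qk : R }.

Section QuatChoice.
Variable R : Type.

Definition tuple_of_quat (q : quat R) := (qre q, qi q, qj q, qk q).
Definition quat_of_tuple (t : R * R * R * R) :=
  let: (a, b, c, d) := t in Quat a b c d.

Lemma tuple_of_quatK : cancel tuple_of_quat quat_of_tuple.
Proof. by case. Qed.

End QuatChoice.

HB.instance Definition _ (R : eqType) :=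
  Equality.copy (quat R) (can_type (@tuple_of_quatK R)).
HB.instance Definition _ (R : choiceType) :=
  Choice.copy (quat R) (can_type (@tuple_of_quatK R)).

Section QuatZmodule.
Variable R : zmodType.
Implicit Types p q r : quat R.

Definition add_quat p q :=
  Quat (qre p + qre q) (qi p + qi q) (qj p + qj q) (qk p + qk q).
Definition opp_quat q := Quat (- qre q) (- qi q) (- qj q) (- qk q).

Lemma add_quatA : associative add_quat.
Proof. by move=> p q r; rewrite /add_quat /= !addrA. Qed.

Lemma add_quatC : commutative add_quat.
Proof.
by move=> p q; congr Quat; rewrite addrC.
Qed.

Lemma add0_quat : left_id (Quat 0 0 0 0) add_quat.
Proof. by case=> a b c d; rewrite /add_quat /= !add0r. Qed.

Lemma addN_quat : left_inverse (Quat 0 0 0 0) opp_quat add_quat.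
Proof. by move=> q; rewrite /add_quat /= !addNr. Qed.

HB.instance Definition _ :=
  GRing.isZmodule.Build (quat R) add_quatA add_quatC add0_quat addN_quat.

End QuatZmodule.

Section QuatRing.
Variable R : comNzRingType.
Implicit Types p q r : quat R.

Definition mul_quat p q :=
  let: Quat a1 b1 c1 d1 := p in
  let: Quat a2 b2 c2 d2 := q in
  Quat (a1 * a2 - b1 * b2 - c1 * c2 - d1 * d2)
       (a1 * b2 + b1 * a2 + c1 * d2 - d1 * c2)
       (a1 * c2 - b1 * d2 + c1 * a2 + d1 * b2)
       (a1 * d2 + b1 * c2 - c1 * b2 + d1 * a2).

Definition one_quat : quat R := Quat 1 0 0 0.

Lemma mul_quatA : associative mul_quat.
Proof.
by case=> ? ? ? ? [? ? ? ?] [? ? ? ?]; rewrite /mul_quat; congr Quat; ring.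
Qed.

Lemma mul1_quat : left_id one_quat mul_quat.
Proof. by case=> ? ? ? ?; rewrite /mul_quat /one_quat; congr Quat; ring. Qed.

Lemma mul_quat1 : right_id one_quat mul_quat.
Proof. by case=> ? ? ? ?; rewrite /mul_quat /one_quat; congr Quat; ring. Qed.

Lemma mul_quatDl : left_distributive mul_quat (@add_quat R).
Proof.
by case=> ? ? ? ? [? ? ? ?] [? ? ? ?]; rewrite /mul_quat /add_quat /=; congr Quat; ring.
Qed.

Lemma mul_quatDr : right_distributive mul_quat (@add_quat R).
Proof.
by case=> ? ? ? ? [? ? ? ?] [? ? ? ?]; rewrite /mul_quat /add_quat /=; congr Quat; ring.
Qed.

Lemma one_quat_neq0 : one_quat != 0.
Proof. by apply/eqP => -[] /eqP; rewrite oner_eq0. Qed.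

HB.instance Definition _ := GRing.Zmodule_isNzRing.Build (quat R)
  mul_quatA mul1_quat mul_quat1 mul_quatDl mul_quatDr one_quat_neq0.

Definition conj_quat q : quat R := Quat (qre q) (- qi q) (- qj q) (- qk q).

Definition quat_of_real (a : R) : quat R := Quat a 0 0 0.

Lemma quat_units (i := Quat 0 1 0 0 : quat R) (j := Quat 0 0 1 0 : quat R)
    (k := Quat 0 0 0 1 : quat R) :
  [/\ i ^+ 2 = -1, j ^+ 2 = -1, k ^+ 2 = -1 & i * j * k = -1].
Proof.
split; rewrite ?expr2 /i /j /k;
  by rewrite /GRing.mul /GRing.opp /= /opp_quat /=; congr Quat; ring.
Qed.

End QuatRing.

Definition quat_of_complex (R : nmodType) (z : complex R) : quat R :=
  Quat (complex.Re z) (complex.Im z) 0 0.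

Definition norm_quat (R : rcfType) (q : quat R) : R :=
  Num.sqrt (qre q ^+ 2 + qi q ^+ 2 + qj q ^+ 2 + qk q ^+ 2).

Lemma norm_quatE (R : rcfType) (q : quat R) :
  q * conj_quat q = quat_of_real (norm_quat q ^+ 2).
Proof.
rewrite /norm_quat sqr_sqrtr ?addr_ge0 ?sqr_ge0 //; case: q => a b c d.
by rewrite /GRing.mul /= /conj_quat /quat_of_real /=; congr Quat; ring.
Qed.

Section NumericalRange.
Variables (R : rcfType) (F : nzRingType) (conj : F -> F) (nrm : F -> R).
Variable n : nat.

Definition conjtr (x : 'cV[F]_n) : 'rV[F]_n := (map_mx conj x)^T.

Definition vnorm (x : 'cV[F]_n) : R := Num.sqrt (\sum_(l < n) nrm (x l 0) ^+ 2).

Definition numrange (A : 'M[F]_n) : set F :=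
  [set w | exists2 x : 'cV[F]_n,
             vnorm x = 1 & w = (conjtr x *m A *m x) 0 0]%classic.

End NumericalRange.

(* [normc] is the R-valued modulus; `|z| would live in R[i]. *)
Definition WC (R : rcfType) n (A : 'M[complex R]_n) : set (complex R) :=
  numrange (@conjc R) (@ComplexField.Normc.normc R) A.

Definition WH (R : rcfType) n (A : 'M[quat R]_n) : set (quat R) :=
  numrange (@conj_quat R) (@norm_quat R) A.

Definition similar_quat (R : rcfType) (q1 q2 : quat R) : Prop :=
  exists2 s : quat R, norm_quat s = 1 & conj_quat s * q2 * s = q1.

Definition quat_class (R : rcfType) (q : quat R) : set (quat R) :=
  [set p | similar_quat p q]%classic.

(* Main.v *)
(** After right multiplication of [x] by a unit quaternion, [x^* A x] is a
complex number.  Write then [x = y + z j] with complex vectors [y] and [z]: as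
[A] is real, [x^* A x] is the sum of the values of the form at [y] and at the
conjugate of [z].  By the Toeplitz-Hausdorff convexity argument some complex
unit vector in the span of these two attains this sum: the identity is a
positive semidefinite 2 x 2 Hermitian matrix on which the norm and the real and
imaginary parts of the form take the desired values, these are three linear
functionals on a real space of dimension four, so one can move in a direction
killed by them until the matrix has rank at most one. *)

Require Import Defs.
From mathcomp Require Import all_boot all_order all_algebra.
From mathcomp Require Import complex classical_sets reals.
From mathcomp Require Import ring lra.

Import Order.TTheory GRing.Theory Num.Theory.

Local Open Scope ring_scope.
Local Open Scope classical_set_scope.

(** * Positive semidefinite 2 x 2 Hermitian matrices *)

(** A singular positive semidefinite matrix [[[p, e + i f], [e - i f, s]]] has rank at most one, so
    its entries are [conj(c_i) c_j] with [c_k = a_k + i b_k]. *)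
Lemma rank_le1_hermitian (R : rcfType) (p s e f : R) :
  0 <= p -> 0 <= s -> p * s = e ^+ 2 + f ^+ 2 ->
  exists a1 b1 a2 b2 : R,
    [/\ a1 ^+ 2 + b1 ^+ 2 = p, a2 ^+ 2 + b2 ^+ 2 = s,
        a1 * a2 + b1 * b2 = e & a1 * b2 - b1 * a2 = f].
Proof.
move=> p0 s0 ps; have [pE|pn0] := eqVneq p 0.
  exists 0, 0, (Num.sqrt s), 0.
  have /eqP : e ^+ 2 + f ^+ 2 = 0 by rewrite -ps pE mul0r.
  rewrite paddr_eq0 ?sqr_ge0 // !sqrf_eq0 => /andP[/eqP -> /eqP ->].
  by split; rewrite ?sqr_sqrtr // ?pE; ring.
have sp : Num.sqrt p ^+ 2 = p by rewrite sqr_sqrtr.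
have spn0 : Num.sqrt p != 0 by rewrite -sqrf_eq0 sp.
exists (Num.sqrt p), 0, (e / Num.sqrt p), (f / Num.sqrt p).
split; [by rewrite sp; ring | | by field | by field].
by rewrite !expr_div_n sp -mulrDl -ps mulrAC divff // mul1r.
Qed.

(* The coordinates of a row of length 4 stand for the Hermitian matrix
   [[t0, t2 + i t3], [t2 - i t3, t1]]. *)
Lemma hermitian_rank_le1_reduction (R : rcfType) (m : nat) (M : 'M[R]_(4, m)) :
  (m < 4)%N ->
  exists a1 b1 a2 b2 : R, forall k,
    (a1 ^+ 2 + b1 ^+ 2) * M 0 k + (a2 ^+ 2 + b2 ^+ 2) * M 1 k
    + (a1 * a2 + b1 * b2) * M 2%:R k + (a1 * b2 - b1 * a2) * M 3%:R k
    = M 0 k + M 1 k.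
Proof.
move=> m4.
(* The columns of [M] are fewer than four functionals, so they share a nonzero kernel element. *)
have [t t0 tM] : exists2 t : 'rV[R]_4, t != 0 & t *m M = 0.
  exists (nz_row (kermx M)); last by apply/sub_kermxP/nz_row_sub.
  rewrite nz_row_eq0 -mxrank_eq0 mxrank_ker subn_eq0 -ltnNge.
  exact: leq_ltn_trans (rank_leq_col M) m4.
(* The sign of [t] is free; a nonnegative trace makes its larger eigenvalue positive. *)
wlog tr_ge0 : t t0 tM / 0 <= t 0 0 + t 0 1.
  move=> IH; have [|lt0] := leP 0 (t 0 0 + t 0 1); first exact: IH t0 tM.
  apply: (IH (- t)); rewrite ?oppr_eq0 ?mulNmx ?tM ?oppr0 //.
  by rewrite !mxE -opprD oppr_ge0 ltW.
pose a := t 0 0; pose d := t 0 1; pose b := t 0 2%:R; pose c := t 0 3%:R.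
have tMk k : a * M 0 k + d * M 1 k + b * M 2%:R k + c * M 3%:R k = 0.
  have := congr1 (fun B : 'rV_m => B 0 k) tM; rewrite !mxE.
  rewrite !big_ord_recl big_ord0 addr0 !addrA => <-.
  congr (_ + _ + _ + _); congr (t _ _ * M _ _); exact/val_inj.
have t_eq0 : a = 0 -> d = 0 -> b = 0 -> c = 0 -> False.
  move=> a0 d0 b0 c0; move/eqP: t0; apply; apply/rowP => i; rewrite mxE.
  case: i => -[|[|[|[|//]]]] Hi.
  - by rewrite -[RHS]a0; congr (t _ _); exact/val_inj.
  - by rewrite -[RHS]d0; congr (t _ _); exact/val_inj.
  - by rewrite -[RHS]b0; congr (t _ _); exact/val_inj.
  - by rewrite -[RHS]c0; congr (t _ _); exact/val_inj.
(* [l] is the largest eigenvalue of [t] in absolute value. *)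
pose h := (a - d) / 2%:R; pose r := Num.sqrt (h ^+ 2 + b ^+ 2 + c ^+ 2).
pose l := (a + d) / 2%:R + r.
have r0 : 0 <= r := sqrtr_ge0 _.
have r2 : r ^+ 2 = h ^+ 2 + b ^+ 2 + c ^+ 2.
  by rewrite sqr_sqrtr // !addr_ge0 ?sqr_ge0.
have [hr1 hr2] : - r <= h /\ h <= r.
  have : `|h| <= `|r|.
    by rewrite -ler_sqr ?nnegrE // !real_normK ?num_real // r2; nra.
  by rewrite (ger0_norm r0) ler_norml => /andP.
have adE : 0 <= a + d by [].
have l_gt0 : 0 < l.
  rewrite lt_def; apply/andP; split; last by rewrite /l; lra.
  apply/eqP => l0.
  have rE : r = 0 by rewrite /l in l0; lra.
  have adE0 : a + d = 0 by rewrite /l in l0; lra.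
  have /eqP : h ^+ 2 + b ^+ 2 + c ^+ 2 = 0 by rewrite -r2 rE expr0n.
  rewrite !paddr_eq0 ?addr_ge0 ?sqr_ge0 // !sqrf_eq0.
  move=> /andP[/andP[/eqP hE /eqP bE] /eqP cE].
  by apply: t_eq0 => //; rewrite /h in hE; lra.
have ln0 : l != 0 by rewrite gt_eqF.
(* The matrix [1 - t / l] is singular and positive semidefinite because [l] is the larger eigenvalue
   of [t]; the functionals take the same values on it as on the identity. *)
have [|||a1 [b1 [a2 [b2 [pE sE eE fE]]]]] :=
    @rank_le1_hermitian R (1 - a / l) (1 - d / l) (- b / l) (- c / l).
- by rewrite subr_ge0 ler_pdivrMr // mul1r /l; rewrite /h in hr1 hr2; lra.
- by rewrite subr_ge0 ler_pdivrMr // mul1r /l; rewrite /h in hr1 hr2; lra.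
- have -> : 1 - a / l = (r - h) / l.
    by rewrite -[1](divff ln0) -mulrBl /h /l; congr (_ / _); field.
  have -> : 1 - d / l = (r + h) / l.
    by rewrite -[1](divff ln0) -mulrBl /h /l; congr (_ / _); field.
  rewrite !expr_div_n !sqrrN -mulrDl mulrACA -invfM -expr2; congr (_ / _).
  by rewrite -subr_sqr r2; ring.
exists a1, b1, a2, b2 => k; rewrite pE sE eE fE.
rewrite -[RHS]subr0 -[X in _ = _ - X](mul0r l^-1) -(tMk k).
by field.
Qed.

(** * Expansion of sesquilinear forms *)

Lemma conjtr_mulE (F : nzRingType) (conj : F -> F) (n : nat) (B : 'M[F]_n)
    (x y : 'cV[F]_n) :
  (conjtr conj x *m B *m y) 0 0 =
  \sum_i \sum_j conj (x i 0) * B i j * y j 0.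
Proof.
rewrite mxE exchange_big; apply: eq_bigr => j _.
by rewrite mxE big_distrl /=; apply: eq_bigr => i _; rewrite !mxE.
Qed.

Lemma sesquilinear_comb (F : comNzRingType) (conj : {rmorphism F -> F})
    (n : nat) (B : 'M[F]_n) (c1 c2 : F) (u v : 'cV[F]_n) :
  let f (x y : 'cV[F]_n) := (conjtr conj x *m B *m y) 0 0 in
  let w := c1 *: u + c2 *: v in
  f w w = conj c1 * c1 * f u u + conj c1 * c2 * f u v
          + conj c2 * c1 * f v u + conj c2 * c2 * f v v.
Proof.
rewrite /= !conjtr_mulE !mulr_sumr -!big_split; apply: eq_bigr => i _ /=.
rewrite !mulr_sumr -!big_split; apply: eq_bigr => j _ /=.
by rewrite !mxE rmorphD !rmorphM; ring.
Qed.

Lemma vnorm_eq1 (R : rcfType) (F : nzRingType) (nrm : F -> R) (n : nat)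
    (x : 'cV[F]_n) :
  vnorm nrm x = 1 <-> \sum_(l < n) nrm (x l 0) ^+ 2 = 1.
Proof.
rewrite /vnorm; split=> [h|->]; last by rewrite sqrtr1.
by rewrite -[LHS]sqr_sqrtr ?h ?expr1n // sumr_ge0 // => l _; rewrite sqr_ge0.
Qed.

(** * Convexity argument for the complex form *)

Section ComplexForm.
Variables (R : rcfType) (n : nat).
Local Notation C := (complex R).
Implicit Types (B : 'M[C]_n) (u v : 'cV[C]_n).

Definition cform B u v : C := (conjtr (@conjc R) u *m B *m v) 0 0.

Lemma cform_comb B (c1 c2 : C) u v :
  let w := c1 *: u + c2 *: v in
  cform B w w =
    conjc c1 * c1 * cform B u u + conjc c1 * c2 * cform B u v
    + conjc c2 * c1 * cform B v u + conjc c2 * c2 * cform B v v.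
Proof. exact: sesquilinear_comb. Qed.

Lemma sum_normc_sqr u :
  \sum_(l < n) ComplexField.Normc.normc (u l 0) ^+ 2 =
  complex.Re (cform 1%:M u u).
Proof.
rewrite /cform mulmx1 mxE raddf_sum; apply: eq_bigr => l _; rewrite !mxE.
case: (u l 0) => a b /=.
by rewrite sqr_sqrtr ?addr_ge0 ?sqr_ge0 //; ring.
Qed.

(** The form at [c1 u + c2 v] is the combination of these four values with real coefficients
    [|c1|^2], [|c2|^2], [Re(conj(c1) c2)] and [Im(conj(c1) c2)]. *)
Definition hermitian_coords B u v : seq C :=
  [:: cform B u u; cform B v v; cform B u v + cform B v u;
      Complex 0 1 * (cform B u v - cform B v u)].

Lemma WC_sum B u v :
  \sum_(l < n) ComplexField.Normc.normc (u l 0) ^+ 2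
    + \sum_(l < n) ComplexField.Normc.normc (v l 0) ^+ 2 = 1 ->
  WC B (cform B u u + cform B v v).
Proof.
rewrite !sum_normc_sqr => uv1.
(* The three columns give the real and imaginary parts of the form of [B], and the squared norm as
   the form of the identity matrix. *)
pose M : 'M[R]_(4, 3) := \matrix_(i, k)
  [:: complex.Re (hermitian_coords B u v)`_i;
      complex.Im (hermitian_coords B u v)`_i;
      complex.Re (hermitian_coords 1%:M u v)`_i]`_k.
have [//|a1 [b1 [a2 [b2 E]]]] := @hermitian_rank_le1_reduction R 3 M.
pose w := Complex a1 b1 *: u + Complex a2 b2 *: v.
have EB := cform_comb B (Complex a1 b1) (Complex a2 b2) u v.
have E1 := cform_comb 1%:M (Complex a1 b1) (Complex a2 b2) u v.
exists w.
  apply/vnorm_eq1; rewrite sum_normc_sqr -uv1 E1.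
  have := E 2%:R; rewrite !mxE /=.
  case: (cform _ u u) (cform _ u v) (cform _ v u) (cform _ v v)
    => [? ?] [? ?] [? ?] [? ?] /= <-; ring.
rewrite -/(cform B w w) EB.
have := E 0; have := E 1; rewrite !mxE /=.
case: (cform _ u u) (cform _ u v) (cform _ v u) (cform _ v v)
  => [? ?] [? ?] [? ?] [? ?] /= E1' E0'.
apply/eqP; rewrite eq_complex /=; apply/andP; split; apply/eqP.
  by rewrite -E0'; ring.
by rewrite -E1'; ring.
Qed.

End ComplexForm.

Arguments cform {R n}.

(** * Quaternion arithmetic and similarity *)

Lemma mul_quatE (R : comNzRingType) (a1 b1 c1 d1 a2 b2 c2 d2 : R) :
  Quat a1 b1 c1 d1 * Quat a2 b2 c2 d2 =
  Quat (a1 * a2 - b1 * b2 - c1 * c2 - d1 * d2)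
       (a1 * b2 + b1 * a2 + c1 * d2 - d1 * c2)
       (a1 * c2 - b1 * d2 + c1 * a2 + d1 * b2)
       (a1 * d2 + b1 * c2 - c1 * b2 + d1 * a2).
Proof. by []. Qed.

Lemma conj_quatM (R : comNzRingType) (p q : quat R) :
  conj_quat (p * q) = conj_quat q * conj_quat p.
Proof.
case: p q => [? ? ? ?] [? ? ? ?].
by rewrite /conj_quat mul_quatE /=; congr Quat; ring.
Qed.

Lemma conj_quatK (R : comNzRingType) : involutive (@conj_quat R).
Proof. by case=> ? ? ? ?; rewrite /conj_quat /= !opprK. Qed.

Section QuaternionForm.
Variable R : rcfType.
Local Notation H := (quat R).

Lemma norm_quat_sqr (q : H) :
  norm_quat q ^+ 2 = qre q ^+ 2 + qi q ^+ 2 + qj q ^+ 2 + qk q ^+ 2.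
Proof. by rewrite sqr_sqrtr // !addr_ge0 ?sqr_ge0. Qed.

(** This is Euler's four-square identity. *)
Lemma norm_quatM_sqr (p q : H) :
  norm_quat (p * q) ^+ 2 = norm_quat p ^+ 2 * norm_quat q ^+ 2.
Proof.
rewrite !norm_quat_sqr; case: p q => [? ? ? ?] [? ? ? ?].
by rewrite mul_quatE /=; ring.
Qed.

Lemma norm_conj_quat (q : H) : norm_quat (conj_quat q) = norm_quat q.
Proof. by rewrite /norm_quat /= !sqrrN. Qed.

Lemma mul_conj_quat_unit (s : H) : norm_quat s = 1 -> s * conj_quat s = 1.
Proof. by move=> s1; rewrite norm_quatE s1 expr1n. Qed.

Lemma mul_quat_conj_unit (s : H) : norm_quat s = 1 -> conj_quat s * s = 1.
Proof.
by rewrite -norm_conj_quat => /mul_conj_quat_unit; rewrite conj_quatK.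
Qed.

(** Right multiplication of [x] by [s] preserves the norm, and [s] comes out of the form on both
    sides: [(x s)^* B (x s) = s^* (x^* B x) s]. *)
Lemma WH_conj_unit n (B : 'M[H]_n) (w s : H) :
  norm_quat s = 1 -> WH B w -> WH B (conj_quat s * w * s).
Proof.
move=> s1 [x /vnorm_eq1 x1 ->]; exists (map_mx ( *%R^~ s) x).
  apply/vnorm_eq1; rewrite -x1; apply: eq_bigr => l _.
  by rewrite mxE norm_quatM_sqr s1 expr1n mulr1.
rewrite !conjtr_mulE mulr_sumr mulr_suml; apply: eq_bigr => i _.
rewrite mulr_sumr mulr_suml; apply: eq_bigr => j _.
by rewrite !mxE conj_quatM !mulrA.
Qed.

(* The vector part [v] of [q] satisfies [v^2 = - r^2], so [s = v + r i] gives
   [v s = s (r i)]; it vanishes only if [q] is already complex. *)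
Lemma similar_complex (q : H) :
  exists2 s, norm_quat s = 1 &
    exists z : complex R, conj_quat s * q * s = quat_of_complex z.
Proof.
case: q => a b c d.
have [cd0|cd0] := eqVneq (c ^+ 2 + d ^+ 2) 0.
  move/eqP: cd0; rewrite paddr_eq0 ?sqr_ge0 // !sqrf_eq0.
  case/andP=> /eqP -> /eqP ->; exists 1.
    by rewrite /norm_quat /= expr1n !expr0n /= !addr0 sqrtr1.
  exists (Complex a b).
  by rewrite mulr1 /conj_quat /= !oppr0 mul1r.
pose r := Num.sqrt (b ^+ 2 + c ^+ 2 + d ^+ 2).
have r2 : r ^+ 2 = b ^+ 2 + c ^+ 2 + d ^+ 2.
  by rewrite sqr_sqrtr // !addr_ge0 ?sqr_ge0.
pose N := Num.sqrt ((b + r) ^+ 2 + c ^+ 2 + d ^+ 2).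
have N2 : N ^+ 2 = (b + r) ^+ 2 + c ^+ 2 + d ^+ 2.
  by rewrite sqr_sqrtr // !addr_ge0 ?sqr_ge0.
have N0 : N != 0.
  rewrite -sqrf_eq0 N2 -addrA paddr_eq0 ?addr_ge0 ?sqr_ge0 //.
  by rewrite (negPf cd0) andbF.
pose s : H := Quat 0 ((b + r) / N) (c / N) (d / N).
have s1 : norm_quat s = 1.
  rewrite /norm_quat /= !expr_div_n expr0n add0r -!mulrDl -N2 divff ?sqrtr1 //.
  by rewrite sqrf_eq0.
exists s => //; exists (Complex a r).
suff sE : Quat a b c d * s = s * quat_of_complex (Complex a r).
  by rewrite -mulrA sE mulrA mul_quat_conj_unit // mul1r.
rewrite /s /quat_of_complex !mul_quatE /=; congr Quat; field: r2 => //.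
Qed.

(** * Passing between complex and quaternionic forms *)

Lemma quat_of_complexD (y z : complex R) :
  quat_of_complex (y + z) = quat_of_complex y + quat_of_complex z.
Proof.
case: y z => [? ?] [? ?].
by rewrite /quat_of_complex /GRing.add /= /add_quat /= !addr0.
Qed.

Lemma quat_of_complexM (y z : complex R) :
  quat_of_complex (y * z) = quat_of_complex y * quat_of_complex z.
Proof.
case: y z => [? ?] [? ?].
by rewrite /quat_of_complex mul_quatE /=; congr Quat; ring.
Qed.

Lemma quat_of_complex_conj (z : complex R) :
  quat_of_complex (conjc z) = conj_quat (quat_of_complex z).
Proof. by case: z => ? ?; rewrite /quat_of_complex /conj_quat /= oppr0. Qed.

Lemma quat_of_complex_sum (I : Type) (r : seq I) (F : I -> complex R) :
  quat_of_complex (\sum_(i <- r) F i) = \sum_(i <- r) quat_of_complex (F i).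
Proof. exact: (big_morph _ quat_of_complexD). Qed.

Definition complex_part (q : H) : complex R := Complex (qre q) (qi q).

Lemma complex_part_sum (I : Type) (r : seq I) (F : I -> H) :
  complex_part (\sum_(i <- r) F i) = \sum_(i <- r) complex_part (F i).
Proof. by apply: (big_morph complex_part). Qed.

(* [q = complex_part q + (j_part q)^* j] *)
Definition j_part (q : H) : complex R := Complex (qj q) (- qk q).

(** The real [a] commutes with [j], so the cross terms lie in [C j] and drop out; the conjugate in
    [j_part] gives the other term the shape of a complex form. *)
Lemma complex_part_form (p q : H) (a : R) :
  complex_part (conj_quat p * quat_of_real a * q) =
  conjc (complex_part p) * real_complex R a * complex_part q
  + conjc (j_part p) * real_complex R a * j_part q.
Proof.
case: p q => [? ? ? ?] [? ? ? ?].
rewrite /conj_quat /quat_of_real !mul_quatE.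
by apply/eqP; rewrite eq_complex /=; apply/andP; split; apply/eqP; ring.
Qed.

Lemma WC_complex_part n (A : 'M[R]_n) (w : H) :
  WH (map_mx (@quat_of_real R) A) w ->
  WC (map_mx (real_complex R) A) (complex_part w).
Proof.
case=> x /vnorm_eq1 x1 ->.
pose y := map_mx complex_part x; pose z := map_mx j_part x.
set B := map_mx (real_complex R) A.
have -> : complex_part ((conjtr (@conj_quat R) x *m map_mx (@quat_of_real R) A
    *m x) 0 0) = cform B y y + cform B z z.
  rewrite /cform !conjtr_mulE complex_part_sum -big_split; apply: eq_bigr => i _.
  rewrite complex_part_sum -big_split; apply: eq_bigr => j _.
  by rewrite !mxE complex_part_form.
apply: WC_sum; rewrite -x1 -big_split; apply: eq_bigr => l _ /=.
rewrite !mxE norm_quat_sqr /= !sqr_sqrtr ?addr_ge0 ?sqr_ge0 //.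
by rewrite sqrrN addrA.
Qed.

Lemma WH_of_complex n (A : 'M[R]_n) (z : complex R) :
  WC (map_mx (real_complex R) A) z ->
  WH (map_mx (@quat_of_real R) A) (quat_of_complex z).
Proof.
case=> x /vnorm_eq1 x1 ->; exists (map_mx (@quat_of_complex R) x).
  apply/vnorm_eq1; rewrite -x1; apply: eq_bigr => l _.
  rewrite mxE norm_quat_sqr; case: (x l 0) => a b /=.
  by rewrite sqr_sqrtr ?addr_ge0 ?sqr_ge0 // expr0n !addr0.
rewrite !conjtr_mulE quat_of_complex_sum; apply: eq_bigr => i _.
rewrite quat_of_complex_sum; apply: eq_bigr => j _.
by rewrite !mxE -quat_of_complex_conj !quat_of_complexM.
Qed.

End QuaternionForm.

Theorem theorem3p7 (R : realType) (n : nat) (hn : (1 <= n)%N) (A : 'M[R]_n) :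
  WH (map_mx (@quat_of_real R) A) =
  \bigcup_(w in WC (map_mx (real_complex R) A)) quat_class (quat_of_complex w).
Proof.
apply/seteqP; split=> [q qW|_ [w wW [s s1 <-]]]; last first.
  exact/WH_conj_unit/WH_of_complex.
have [s s1 [z zE]] := similar_complex _ q.
exists z.
  (* The rotated value is already complex, so taking its complex part loses nothing. *)
  have -> : z = complex_part _ (quat_of_complex z) by case: z {zE}.
  by apply: WC_complex_part; rewrite -zE; exact: WH_conj_unit.
(* The inverse of the unit [s] rotates back to [q]. *)
exists (conj_quat s); first by rewrite norm_conj_quat.
rewrite -zE conj_quatK !mulrA mul_conj_quat_unit // mul1r.
by rewrite -mulrA mul_conj_quat_unit // mulr1.
Qed.
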